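(* Let $G=(V,E,w)$ be a finite undirected loopless graph with $n$ vertices and nonnegative edge weights $w_e\ge 0$ ($e\in E$), and let $\vartheta\in\mathbb{R}$ with $-1\le\vartheta\le 1$. For $0\le k\le n$ let $A_k$ and $D_k$ be the weighted adjacency and degree matrices of the $k$-token graph $F_k(G)$, and let $h_k^{(\vartheta)}=\lambda_{\max}(A_k+\vartheta D_k)$. Then $$2h_k^{(\vartheta)}\ \ge\ h_{k-1}^{(\vartheta)}+h_{k+1}^{(\vartheta)}\qquad(1\le k\le n-1).$$ Furthermore, $h_k^{(\vartheta)}=h_{n-k}^{(\vartheta)}$ for $0\le k\le n$, and hence $$h_k^{(\vartheta)}\le h_{k+1}^{(\vartheta)}\qquad(0\le k<n/2).$$
   Context: Edges of $G$ are two-element subsets $\{i,j\}$ of $V$. No connectedness is assumed, and zero weights are allowed. For $0\le k\le n$, the weighted $k$-token graph $F_k(G)$ has vertex set $\binom{V}{k}=\{S\subseteq V:|S|=k\}$. Its weighted adjacency matrix $A_k$, indexed by $\binom Vk$, has entries $(A_k)_{S,T}=w_{\{i,j\}}$ if the symmetric difference $S\triangle T=\{i,j\}$ is an edge in $E$, and $(A_k)_{S,T}=0$ otherwise. Its weighted degree matrix is $D_k=\operatorname{diag}(d_k(S):S\in\binom Vk)$ with $d_k(S)=\sum_{e\in E,\ |S\cap e|=1}w_e$. For $k=0$ and $k=n$ these are the $1\times1$ zero matrices. $\lambda_{\max}(M)$ denotes the largest eigenvalue of a real symmetric matrix $M$. *)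

(* Defs.v *)
From HB Require Import structures.
From mathcomp Require Import all_boot all_order all_algebra.
From mathcomp Require Import all_classical all_reals.

Set Implicit Arguments.
Unset Strict Implicit.
Unset Printing Implicit Defensive.

Import Order.TTheory GRing.Theory Num.Theory.
Local Open Scope ring_scope.

(* The spectrum of a real symmetric matrix of positive size is finite and
   nonempty, so this supremum is a maximum. *)
Definition lambda_max (R : realType) (N : nat) (M : 'M[R]_N) : R :=
  sup [set a : R | eigenvalue M a]%classic.

Section TokenGraph.
Variables (R : realType) (V : finType).

(* A weighted graph on V is given by its edge set E, whose members are
   two-element subsets of V, and a weight function w, of which only the values
   on E are ever used. *)
Variables (E : {set {set V}}) (w : {set V} -> R).

Definition token_sets (k : nat) : {set {set V}} :=
  [set S : {set V} | #|S| == k].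

Definition symdiff (S T : {set V}) : {set V} := (S :\: T) :|: (T :\: S).

Definition token_adj (k : nat) : 'M[R]_#|token_sets k| :=
  \matrix_(i, j) let U := symdiff (enum_val i) (enum_val j) in
                 if U \in E then w U else 0.

Definition token_degree (S : {set V}) : R :=
  \sum_(e in E | #|S :&: e| == 1%N) w e.

Definition token_deg (k : nat) : 'M[R]_#|token_sets k| :=
  diag_mx (\row_i token_degree (enum_val i)).

Definition token_lambda_max (theta : R) (k : nat) : R :=
  lambda_max (token_adj k + theta *: token_deg k).

End TokenGraph.

(* Main.v *)
(** Write H for the operator A + theta D on functions on all subsets of V: it is
    a sum over the edges e of w_e times an operator that acts on the occupation
    of the two ends of e only, with matrix [[theta, 1], [1, theta]] on the two
    states with exactly one token on e and 0 on the other two.  For small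
    eps > 0 the factors 1 + eps w_e H_e preserve stability (nonvanishing when
    all variables lie in the upper half-plane) of the multiaffine generating
    polynomial sum_S f(S) z^S: the relevant quadratic form in four variables has
    exactly one positive eigenvalue precisely because -1 <= theta <= 1.
    Restricting a stable polynomial with nonnegative coefficients to the
    diagonal gives a real-rooted polynomial, so its rank sums
    sum_(|S| = k) f(S) are log-concave in k.  Apply this to M^N 1, where M is the
    palindromic product of the edge factors, a symmetric operator: as N grows,
    the k-th rank sum grows like the N-th power of the top eigenvalue of M on
    k-sets, which is 1 + 2 eps h_k + O(eps^2); let eps tend to 0.  Complementing
    subsets gives the symmetry, and the two together give monotonicity. *)

Require Import Defs.
From HB Require Import structures.
From mathcomp Require Import all_boot all_order all_algebra.
From mathcomp Require Import all_classical all_reals.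
From mathcomp Require complex.
From mathcomp Require Import zify ring lra.

Set Implicit Arguments.
Unset Strict Implicit.
Unset Printing Implicit Defensive.

Import Order.TTheory GRing.Theory Num.Theory.
Local Open Scope ring_scope.

(** * The edge operator and half-plane stability *)

Section KeyLemma.
Import complex.
Local Open Scope complex_scope.
Variable R : realType.

Definition edge_form (al be x1 x2 x3 x4 : R) : R :=
  x1 * x2 + x3 * x4 + al * (x1 * x4 + x2 * x3) + be * (x1 * x3 + x2 * x4).

(** Normalised so that equal arguments give twice [edge_form]; hence the factor 4 in the reverse
    Cauchy-Schwarz inequality. *)
Definition edge_polar (al be x1 x2 x3 x4 y1 y2 y3 y4 : R) : R :=
  x1 * y2 + x2 * y1 + x3 * y4 + x4 * y3
  + al * (x1 * y4 + x4 * y1 + x2 * y3 + x3 * y2)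
  + be * (x1 * y3 + x3 * y1 + x2 * y4 + x4 * y2).

(** The form is invariant under the Klein four-group permuting the variables, so the characters
    diagonalise it. Under the triangle inequalities for [1], [al], [be], only the square of the
    total sum has a positive coefficient. *)
Lemma edge_form_diag (al be x1 x2 x3 x4 : R) :
  8 * edge_form al be x1 x2 x3 x4 =
  (1 + al + be) * (x1 + x2 + x3 + x4) ^+ 2
  - (al + be - 1) * (x1 + x2 - x3 - x4) ^+ 2
  - (1 + be - al) * (x1 + x4 - x2 - x3) ^+ 2
  - (1 + al - be) * (x1 + x3 - x2 - x4) ^+ 2.
Proof. rewrite /edge_form; ring. Qed.

(** For a suitable [t] the vector [x - t y] has coordinate sum zero, where the form is nonpositive.
    So the quadratic [Q - t * B + t ^+ 2 * P], whose leading coefficient is positive, takes a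
    nonpositive value, and its discriminant is nonnegative. *)
Lemma edge_form_reverse_CS (al be x1 x2 x3 x4 y1 y2 y3 y4 : R) :
  1 <= al + be -> al <= 1 + be -> be <= 1 + al ->
  0 < y1 + y2 + y3 + y4 -> 0 < edge_form al be y1 y2 y3 y4 ->
  4 * edge_form al be x1 x2 x3 x4 * edge_form al be y1 y2 y3 y4
  <= edge_polar al be x1 x2 x3 x4 y1 y2 y3 y4 ^+ 2.
Proof.
move=> h1 h2 h3 sy qy.
pose t := (x1 + x2 + x3 + x4) / (y1 + y2 + y3 + y4).
have tE : t * (y1 + y2 + y3 + y4) = x1 + x2 + x3 + x4.
  by rewrite /t divfK // gt_eqF.
pose Q := edge_form al be x1 x2 x3 x4; pose P := edge_form al be y1 y2 y3 y4.
pose B := edge_polar al be x1 x2 x3 x4 y1 y2 y3 y4.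
have expand : edge_form al be (x1 - t * y1) (x2 - t * y2) (x3 - t * y3)
    (x4 - t * y4) = Q - t * B + t ^+ 2 * P.
  by rewrite /Q /P /B /edge_form /edge_polar; ring.
have nonpos : Q - t * B + t ^+ 2 * P <= 0.
  rewrite -expand; suff : 8 * edge_form al be (x1 - t * y1) (x2 - t * y2)
    (x3 - t * y3) (x4 - t * y4) <= 0 by lra.
  rewrite edge_form_diag.
  have -> : x1 - t * y1 + (x2 - t * y2) + (x3 - t * y3) + (x4 - t * y4) = 0.
    by rewrite (_ : _ + _ = x1 + x2 + x3 + x4 - t * (y1 + y2 + y3 + y4));
      [rewrite tE subrr | ring].
  rewrite expr0n /= mulr0 sub0r.
  have c1 : 0 <= al + be - 1 by lra.
  have c2 : 0 <= 1 + be - al by lra.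
  have c3 : 0 <= 1 + al - be by lra.
  have m1 := mulr_ge0 c1 (sqr_ge0 (x1 - t * y1 + (x2 - t * y2) - (x3 - t * y3) - (x4 - t * y4))).
  have m2 := mulr_ge0 c2 (sqr_ge0 (x1 - t * y1 + (x4 - t * y4) - (x2 - t * y2) - (x3 - t * y3))).
  have m3 := mulr_ge0 c3 (sqr_ge0 (x1 - t * y1 + (x3 - t * y3) - (x2 - t * y2) - (x4 - t * y4))).
  lra.
rewrite -/Q -/P -/B in qy *.
have -> : B ^+ 2 = (B - 2 * t * P) ^+ 2 - 4 * P * (Q - t * B + t ^+ 2 * P) + 4 * Q * P by ring.
have := sqr_ge0 (B - 2 * t * P).
have : 4 * P * (Q - t * B + t ^+ 2 * P) <= 0 by apply: mulr_ge0_le0 => //; lra.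
lra.
Qed.

(* With [D = D1 + i D2] the last hypothesis says [|D| - Re D >= 2 l]; it lets
   one write [D] as a product of two numbers whose imaginary parts
   exceed [g] and [d]. *)
Lemma split_product (D1 D2 g d l : R) : 0 <= g -> 0 <= d -> g * d < l ->
  4 * l * (D1 + l) <= D2 ^+ 2 ->
  exists xi : R[i], [/\ g < Im xi, d < Im ((D1 +i* D2) / xi) & xi != 0].
Proof.
move=> g0 d0 gdl hD.
(* Enlarging [d] slightly keeps [g * d' < l]. The witness will have imaginary part [l' / d' > g],
   and the other factor imaginary part at least [d']. *)
pose d' := d + (l - g * d) / (2 * (g + 1)).
have slack : 0 < (l - g * d) / (2 * (g + 1)) by apply: divr_gt0; lra.
have dd' : d < d' by rewrite /d'; lra.
have gd'l : g * d' < l.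
  have : g * ((l - g * d) / (2 * (g + 1))) < l - g * d.
    rewrite mulrA ltr_pdivrMr; last by lra.
    nra.
  by rewrite /d' mulrDr; lra.
have d'0 : 0 < d' by lra.
have gd0 : 0 <= g * d' by apply: mulr_ge0; lra.
pose l' := (g * d' + l) / 2.
have l'0 : 0 < l' by rewrite /l'; lra.
have l'l : l' < l by rewrite /l'; lra.
have strict : 4 * l' * (D1 + l') < D2 ^+ 2.
  have [Dl|Dl] := lerP 0 (D1 + l); last by have := sqr_ge0 D2; nra.
  by nra.
(* The target is [d' * (x ^+ 2 + y ^+ 2) <= D2 * x - D1 * y]; this [x] maximises
   [D2 * x - d' * x ^+ 2]. *)
pose x := D2 / (2 * d'); pose y := l' / d'.
have xE : D2 = 2 * d' * x by rewrite /x; field; lra.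
have yE : l' = d' * y by rewrite /y; field; lra.
have gy : g < y by rewrite /y ltr_pdivlMr // /l'; lra.
have y0 : 0 < y by lra.
have n0 : 0 < x ^+ 2 + y ^+ 2.
  by have := sqr_ge0 x; have := exprn_gt0 2 y0; lra.
exists (x +i* y); split => //=; last by rewrite eq_complex /= negb_and (gt_eqF y0) orbT.
apply: (lt_le_trans dd').
rewrite (_ : _ + _ = (D2 * x - D1 * y) / (x ^+ 2 + y ^+ 2)); last first.
  by field; rewrite gt_eqF.
rewrite ler_pdivlMr //.
move: strict; rewrite xE yE => st.
have : 0 < d' * (4 * d' * x ^+ 2 - 4 * y * (D1 + d' * y)) by nra.
rewrite pmulr_rgt0 // => {}st.
nra.
Qed.

Definition biaffine_stable (a b c d : R[i]) :=
  forall u v : R[i], 0 < Im u -> 0 < Im v ->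
  a + b * u + c * v + d * (u * v) != 0.

(** The roots satisfy [(u + c) (v + b) = b c - a]. If [Im c < 0], let [v + b] be purely imaginary
    and large: then [u] is close to [- c], and both variables lie in the upper half-plane. *)
Lemma biaffine_stable_Im_ge0 (a b c : R[i]) :
  biaffine_stable a b c 1 -> 0 <= Im c.
Proof.
move=> st; rewrite leNgt; apply/negP => cneg.
pose D := b * c - a.
pose y := 1 + `|Im b| + `|Re D| / - Im c.
have q0 : 0 <= `|Re D| / - Im c by apply: divr_ge0 => //; lra.
have y1 : Im b < y.
  by rewrite /y; have := ler_norm (Im b); lra.
have y0 : 0 < y by rewrite /y; have := normr_ge0 (Im b); lra.
have ydef : Re D < y * - Im c.
  have : `|Re D| / - Im c < y by rewrite /y; have := normr_ge0 (Im b); lra.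
  rewrite ltr_pdivrMr; last by lra.
  by have := ler_norm (Re D); lra.
pose eta : R[i] := 0 +i* y.
have eta0 : eta != 0 by rewrite eq_complex /= negb_and (gt_eqF y0) orbT.
have ImDe : Im (D / eta) = - Re D / y.
  rewrite /eta; case: (D) => D1 D2 /=; field.
  by rewrite gt_eqF.
have := st (D / eta - c) (eta - b); rewrite !raddfB /= => /(_ _ _)/eqP[].
- rewrite (_ : Im (_ / _) = - Re D / y) // subr_gt0 ltr_pdivlMr //; lra.
- by rewrite subr_gt0.
- rewrite /D; field; exact: eta0.
Qed.

Lemma biaffine_stableC (a b c d : R[i]) :
  biaffine_stable a b c d -> biaffine_stable a c b d.
Proof.
move=> st u v u0 v0; have := st v u v0 u0.
by congr (_ != 0); ring.
Qed.

(** A root of the new polynomial is turned into one of the old. The reverse Cauchy-Schwarz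
    inequality, applied to the real and imaginary parts of [(z, w, c, b)], is the hypothesis under
    which [b c - a] splits into two factors, which serve as [u + c] and [v + b]. *)
Lemma biaffine_stable_edge1 (al be : R) (a b c : R[i]) :
  0 <= al -> 0 <= be -> 1 <= al + be -> al <= 1 + be -> be <= 1 + al ->
  biaffine_stable a b c 1 ->
  biaffine_stable a (al%:C * b + be%:C * c) (be%:C * b + al%:C * c) 1.
Proof.
move=> al0 be0 h1 h2 h3 st z w z0 w0; apply/negP => /eqP root.
have cge := biaffine_stable_Im_ge0 st.
have bge := biaffine_stable_Im_ge0 (biaffine_stableC st).
pose q := edge_form al be (Im z) (Im w) (Im c) (Im b).
pose p := edge_form al be (Re z) (Re w) (Re c) (Re b).
pose r := edge_polar al be (Re z) (Re w) (Re c) (Re b) (Im z) (Im w) (Im c) (Im b).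
(* For [d = 1] the polynomial is [(u + c) (v + b) - (b c - a)], and the root
   [(z, w)] forces [b c - a] to be the edge form at [(z, w, c, b)]. *)
have DE : b * c - a = (p - q) +i* r.
  have -> : b * c - a = b * c + z * w + al%:C * (b * z + c * w) + be%:C * (c * z + b * w).
    apply/eqP; rewrite -subr_eq0 -oppr_eq0; apply/eqP; rewrite -root; ring.
  rewrite /p /q /r /edge_form /edge_polar.
  case: (b) (c) (z) (w) => [b1 b2] [c1 c2] [z1 z2] [w1 w2].
  by apply/eqP; rewrite eq_complex /=; apply/andP; split; apply/eqP; ring.
have qgt : Im c * Im b < q.
  rewrite /q /edge_form.
  have zw : 0 < Im z * Im w by apply: mulr_gt0.
  have m1 : 0 <= al * (Im z * Im b + Im w * Im c).
    by apply: mulr_ge0 => //; apply: addr_ge0; apply: mulr_ge0 => //; apply: ltW.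
  have m2 : 0 <= be * (Im z * Im c + Im w * Im b).
    by apply: mulr_ge0 => //; apply: addr_ge0; apply: mulr_ge0 => //; apply: ltW.
  lra.
have q0 : 0 < q by apply: le_lt_trans qgt; apply: mulr_ge0.
have disc : 4 * q * (p - q + q) <= r ^+ 2.
  rewrite subrK mulrAC; apply: edge_form_reverse_CS => //; lra.
have [xi [xc xb xi0]] := split_product cge bge qgt disc.
have := st (xi - c) ((b * c - a) / xi - b); rewrite DE !raddfB /=.
rewrite !subr_gt0 => /(_ xc xb)/eqP[].
have -> : a = b * c - ((p - q) +i* r) by rewrite -DE; ring.
by field.
Qed.

Lemma biaffine_stable_edge (al be : R) (a b c d : R[i]) :
  0 <= al -> 0 <= be -> 1 <= al + be -> al <= 1 + be -> be <= 1 + al ->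
  biaffine_stable a b c d ->
  biaffine_stable a (al%:C * b + be%:C * c) (be%:C * b + al%:C * c) d.
Proof.
move=> al0 be0 h1 h2 h3 st.
have [d0|d0] := eqVneq d 0.
  move=> z w z0 w0; rewrite d0 mul0r addr0.
  (* For [d = 0] the new polynomial is the old one evaluated at [(al z + be w, al w + be z)]. *)
  have pos x y : 0 < Im x -> 0 < Im y -> 0 < Im (al%:C * x + be%:C * y).
    case: x y => [x1 x2] [y1 y2] /= x0 y0; rewrite !mul0r !addr0.
    have [al1|al1] := ltrP 0 al.
      by apply: ltr_wpDr; [apply: mulr_ge0 => //; exact: ltW | exact: mulr_gt0].
    apply: ltr_wpDl; first by apply: mulr_ge0 => //; exact: ltW.
    by apply: mulr_gt0 => //; lra.
  have := st (al%:C * z + be%:C * w) (al%:C * w + be%:C * z) (pos _ _ z0 w0) (pos _ _ w0 z0).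
  by rewrite d0 mul0r addr0; congr (_ != 0); ring.
have st1 : biaffine_stable (a / d) (b / d) (c / d) 1.
  move=> u v u0 v0; rewrite -(mulIr_eq0 _ (mulIf d0)).
  by have := st u v u0 v0; congr (_ != 0); field.
move=> z w z0 w0.
have := biaffine_stable_edge1 al0 be0 h1 h2 h3 st1 z0 w0.
rewrite -(mulIr_eq0 _ (mulIf d0)); congr (_ != 0); by field.
Qed.

End KeyLemma.

(** * Stable multiaffine polynomials indexed by subsets *)

Section Stability.
Import complex.
Local Open Scope complex_scope.
Variables (R : realType) (V : finType).
Implicit Types (f g : {set V} -> R) (z : V -> R[i]) (S e : {set V}).

Definition set_poly f z : R[i] :=
  \sum_(S : {set V}) (f S)%:C * \prod_(i in S) z i.

Definition stable f := forall z, (forall i, 0 < Im (z i)) -> set_poly f z != 0.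

(** When exactly one end of [e] is occupied, [symdiff S e] slides that token to the other end. *)
Definition edge_op (al be : R) e f S : R :=
  if #|S :&: e| == 1%N then al * f S + be * f (symdiff S e) else f S.

Lemma in_symdiff S e i : (i \in symdiff S e) = (i \in S) (+) (i \in e).
Proof. by rewrite !inE; case: (i \in S); case: (i \in e). Qed.

Lemma symdiffK e : involutive (fun S => symdiff S e).
Proof. by move=> S; apply/setP => i; rewrite !in_symdiff addbK. Qed.

Lemma card_setI_pair S (i j : V) : i != j ->
  #|S :&: [set i; j]| = ((i \in S) + (j \in S))%N.
Proof.
move=> ij; rewrite -sum1_card.
rewrite (eq_bigl (fun k => (k \in [set i; j]) && (k \in S))); last first.
  by move=> k; rewrite inE andbC.
rewrite big_mkcondr big_setU1 ?inE //= big_set1.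
by case: (i \in S); case: (j \in S).
Qed.

Section Pair.
Variables (i j : V) (ij : i != j).

(** The coefficient of [z i ^ P * z j ^ Q] in [set_poly f z]. It does not depend on [z i] and [z j],
    so [set_poly] becomes biaffine in these two variables. *)
Definition pair_part f z (P Q : bool) : R[i] :=
  \sum_(S : {set V} | ((i \in S) == P) && ((j \in S) == Q))
    (f S)%:C * \prod_(k | (k != i) && (k != j)) (if k \in S then z k else 1).

Lemma set_poly_pair f z :
  set_poly f z = pair_part f z false false + pair_part f z true false * z i
    + pair_part f z false true * z j + pair_part f z true true * (z i * z j).
Proof.
have partE P Q : \sum_(S : {set V} | ((i \in S) == P) && ((j \in S) == Q))
    (f S)%:C * \prod_(k in S) z k =
    pair_part f z P Q * ((if P then z i else 1) * (if Q then z j else 1)).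
  rewrite mulr_suml; apply: eq_bigr => S /andP[/eqP <- /eqP <-].
  rewrite -mulrA; congr (_ * _).
  by rewrite big_mkcond (bigD1 i) //= (bigD1 j) 1?eq_sym //= mulrA mulrC.
rewrite /set_poly (partition_big (fun S : {set V} => i \in S) predT) //= big_bool /=.
rewrite (partition_big (fun S : {set V} => j \in S) predT) //= big_bool /= !partE.
rewrite (partition_big (fun S : {set V} => j \in S) predT) //= big_bool /= !partE.
ring.
Qed.

Lemma pair_part_eq f z z' (P Q : bool) :
  (forall k, k != i -> k != j -> z k = z' k) -> pair_part f z P Q = pair_part f z' P Q.
Proof.
move=> zz'; apply: eq_bigr => S _; congr (_ * _).
by apply: eq_bigr => k /andP[ki kj]; rewrite zz'.
Qed.

Lemma stable_biaffine f z : stable f -> (forall k, 0 < Im (z k)) ->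
  biaffine_stable (pair_part f z false false) (pair_part f z true false)
    (pair_part f z false true) (pair_part f z true true).
Proof.
move=> st zpos u v u0 v0.
pose z' k := if k == i then u else if k == j then v else z k.
have := st z' _; rewrite set_poly_pair.
have zz' k : k != i -> k != j -> z' k = z k.
  by rewrite /z' => /negbTE -> /negbTE ->.
rewrite !(pair_part_eq _ _ _ zz') /z' eqxx [j == i]eq_sym (negbTE ij) eqxx; apply => // k.
by case: ifP => // _; case: ifP.
Qed.

Lemma pair_part_edge_op_diag al be f z P :
  pair_part (edge_op al be [set i; j] f) z P P = pair_part f z P P.
Proof.
apply: eq_bigr => S /andP[/eqP iS /eqP jS].
by rewrite /edge_op card_setI_pair // iS jS; case: P {iS jS}.
Qed.

Lemma pair_part_edge_op_offdiag al be f z P :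
  pair_part (edge_op al be [set i; j] f) z P (~~ P) =
  al%:C * pair_part f z P (~~ P) + be%:C * pair_part f z (~~ P) P.
Proof.
have -> : pair_part f z (~~ P) P = \sum_(S : {set V} | ((i \in S) == P) && ((j \in S) == ~~ P))
    (f (symdiff S [set i; j]))%:C *
    \prod_(k | (k != i) && (k != j)) (if k \in S then z k else 1).
  rewrite /pair_part (reindex_inj (inv_inj (symdiffK [set i; j]))).
  apply: eq_big => S.
    rewrite !in_symdiff !inE !eqxx orbT /=.
    by case: (i \in S); case: (j \in S); case: P.
  move=> _; congr (_ * _); apply: eq_bigr => k /andP[/negbTE ki /negbTE kj].
  by rewrite in_symdiff !inE ki kj addbF.
rewrite /pair_part !mulr_sumr -big_split /=; apply: eq_bigr => S /andP[/eqP iS /eqP jS].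
rewrite /edge_op card_setI_pair // iS jS (_ : (_ == 1%N)); last by case: P {iS jS}.
by rewrite raddfD /= !rmorphM /=; ring.
Qed.

End Pair.

Lemma stable_edge_op al be e f :
  0 <= al -> 0 <= be -> 1 <= al + be -> al <= 1 + be -> be <= 1 + al ->
  #|e| = 2%N -> stable f -> stable (edge_op al be e f).
Proof.
move=> al0 be0 h1 h2 h3 /eqP /cards2P[i [j [ij ->]]] st z zpos.
rewrite (set_poly_pair ij) !pair_part_edge_op_diag //.
rewrite (pair_part_edge_op_offdiag ij _ _ _ _ true).
rewrite (pair_part_edge_op_offdiag ij _ _ _ _ false) /=.
rewrite [X in _ + X * z j]addrC.
exact: (biaffine_stable_edge al0 be0 h1 h2 h3 (stable_biaffine ij st zpos)).
Qed.

(** The polynomial factors as the product of the [z i + 1], none of which is real. *)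
Lemma stable_const1 : stable (fun=> 1).
Proof.
move=> z zpos; rewrite /set_poly.
have -> : \sum_(S : {set V}) 1%:C * \prod_(i in S) z i = \prod_i (z i + 1).
  rewrite bigA_distr; apply: eq_bigr => S _.
  rewrite (_ : 1%:C = 1) // mul1r [RHS]big_mkcond /= [LHS]big_mkcond.
  by apply: eq_bigr => i _.
apply/prodf_neq0 => i _; apply/eqP => /(congr1 (@Im R)).
by rewrite raddfD /= addr0 => /eqP; rewrite gt_eqF.
Qed.

End Stability.

(** * Log-concavity of the rank sums *)

Section LogConcavity.
Import complex.
Local Open Scope complex_scope.
Variable R : realType.

(** The case [i = j] is the usual notion. Allowing [i <= j] avoids dividing by entries that may
    vanish, and the induction over linear factors needs it. *)
Definition log_concave (a : nat -> R) :=
  forall i j, (i <= j)%N -> a i * a j.+2 <= a i.+1 * a j.+1.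

(** The difference of the two sides is a quadratic in [s]. The terms [s * p_i * p_(j+1)] cancel, and
    [h0], [h1], [h2] say that its three coefficients contribute nonnegatively. *)
Lemma log_concave_mul_XaddC (p : {poly R}) (s : R) : 0 <= s ->
  (forall k, 0 <= p`_k) -> log_concave (nth 0 p) ->
  log_concave (nth 0 (p * ('X + s%:P))).
Proof.
move=> s0 p0 lc i j ij.
have coefE k : (p * ('X + s%:P))`_k = (if k is k'.+1 then p`_k' else 0) + s * p`_k.
  by rewrite mulrDr coefD coefMC [s * _]mulrC; case: k => [|k]; rewrite coefMX.
rewrite !coefE {coefE}.
have h0 : (if i is i'.+1 then p`_i' else 0) * p`_j.+1 <= p`_i * p`_j.
  case: i ij => [|i] ij; first by rewrite mul0r mulr_ge0.
  by case: j ij => // j ij; apply: lc.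
have h2 : s ^+ 2 * (p`_i * p`_j.+2) <= s ^+ 2 * (p`_i.+1 * p`_j.+1).
  by rewrite ler_wpM2l ?sqr_ge0 // lc.
have h1 : s * ((if i is i'.+1 then p`_i' else 0) * p`_j.+2)
    <= s * (p`_i.+1 * p`_j).
  apply: ler_wpM2l => //.
  have step : p`_i * p`_j.+1 <= p`_i.+1 * p`_j.
    case: ltngtP ij => // [ij _|-> _]; last by rewrite mulrC.
    by case: j ij {h0 h2} => // j ij; apply: lc.
  case: i ij h0 h2 step => [|i] ij _ _ step; first by rewrite mul0r mulr_ge0.
  by apply: le_trans step; apply: lc; apply: ltnW.
move: h0 h1 h2; move: (if i is _.+1 then _ else _) => q h0 h1 h2.
rewrite -subr_ge0 in h0; rewrite -subr_ge0 in h1; rewrite -subr_ge0 in h2.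
rewrite -subr_ge0; apply: le_trans (addr_ge0 (addr_ge0 h0 h1) h2) _.
by rewrite le_eqVlt; apply/orP; left; apply/eqP; ring.
Qed.

Lemma prod_XaddC_log_concave (ss : seq R) : all (fun s => 0 <= s) ss ->
  (forall k, 0 <= (\prod_(s <- ss) ('X + s%:P))`_k) /\
  log_concave (nth 0 (\prod_(s <- ss) ('X + s%:P))).
Proof.
elim: ss => [_|s ss IH /= /andP[s0 /IH[p0 lc]]].
  rewrite big_nil; split=> [k|i j _]; first by rewrite coef1 ler0n.
  by rewrite !coef1 /= mulr0 mul0r.
rewrite big_cons mulrC; split; last exact: log_concave_mul_XaddC.
move=> k; rewrite mulrDr coefD coefMC addr_ge0 ?mulr_ge0 //.
by rewrite coefMX; case: ifP.
Qed.

(** Conjugation excludes roots in the lower half-plane too, so all roots are real. They are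
    nonpositive because the coefficients are nonnegative, and [p] is a positive multiple of a
    product of factors [X + s] with [s >= 0]. *)
Lemma real_rooted_log_concave (p : {poly R}) : (forall k, 0 <= p`_k) ->
  (forall x : R[i], 0 < Im x -> (map_poly (real_complex R) p).[x] != 0) ->
  log_concave (nth 0 p).
Proof.
move=> p0 nz; pose pc := map_poly (real_complex R) p.
have [->|pn0] := eqVneq p 0; first by move=> i j _; rewrite !coef0 mul0r.
have [r rE] := closed_field_poly_normal pc.
have lcE : lead_coef pc = (lead_coef p)%:C by apply: lead_coef_map.
have lc0 : 0 < lead_coef p by rewrite lt_def lead_coef_eq0 pn0 p0.
have rootE z : (z \in r) = root pc z.
  rewrite rE rootZ; last by rewrite lcE fmorph_eq0 lead_coef_eq0.
  by rewrite root_prod_XsubC.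
have real z : z \in r -> z = (Re z)%:C /\ 0 <= - Re z.
  rewrite rootE => rz.
  have im1 : Im z <= 0 by rewrite leNgt; apply/negP => /nz; rewrite -/pc (rootP rz) eqxx.
  have im2 : 0 <= Im z.
    rewrite leNgt; apply/negP => imz.
    have := nz z^*; rewrite -/pc.
    have -> : Im z^* = - Im z by case: (z).
    rewrite oppr_gt0 => /(_ imz); apply/negP; rewrite negbK.
    have := complex_root_conj pc z; rewrite /root => <-.
    rewrite (_ : map_poly conjc pc = pc); first by rewrite (rootP rz).
    by rewrite -map_poly_comp; apply: eq_map_poly => x /=; rewrite oppr0.
  have zE : z = (Re z)%:C.
    by apply/eqP; rewrite eq_complex /= eqxx eq_le im1 im2.
  (* At a positive point the leading term is positive and the others are nonnegative. *)
  split=> //; rewrite oppr_ge0 leNgt; apply/negP => x0.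
  move: rz; rewrite zE /root horner_map fmorph_eq0; apply/negP.
  rewrite horner_coef gt_eqF //.
  have sp : (0 < size p)%N by rewrite size_poly_gt0.
  rewrite -(prednK sp) big_ord_recr /=; apply: ltr_wpDl.
    by apply: sumr_ge0 => k _; rewrite mulr_ge0 // exprn_ge0 // ltW.
  by rewrite mulr_gt0 // exprn_gt0.
have pE : p = lead_coef p *: \prod_(s <- [seq - Re z | z <- r]) ('X + s%:P).
  apply: (map_poly_inj (real_complex R)); rewrite -/pc rE lcE.
  rewrite map_polyZ rmorph_prod big_map; congr (_ *: _).
  rewrite !big_seq; apply: eq_bigr => z /real[zE _].
  by rewrite rmorphD /= map_polyX map_polyC /= rmorphN /= -zE rmorphN.
have r0 : all (fun s => 0 <= s) [seq - Re z | z <- r].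
  by apply/allP => _ /mapP[z /real[_ z0] ->].
have [_ lc] := prod_XaddC_log_concave r0.
move=> i j ij; rewrite pE !coefZ mulrACA [X in _ <= X]mulrACA.
by rewrite ler_wpM2l ?lc // mulr_ge0 // ltW.
Qed.

Variable V : finType.
Implicit Type f : {set V} -> R.

Definition rank_sum f (k : nat) : R := \sum_(S : {set V} | #|S| == k) f S.

Lemma rank_sum_log_concave f : (forall S, 0 <= f S) -> stable f ->
  log_concave (rank_sum f).
Proof.
move=> f0 st.
pose p : {poly R} := \sum_(S : {set V}) (f S)%:P * 'X^#|S|.
have pE k : p`_k = rank_sum f k.
  rewrite coef_sum /rank_sum [RHS]big_mkcond; apply: eq_bigr => S _.
  by rewrite coefCM coefXn eq_sym; case: eqP; rewrite ?mulr1 ?mulr0.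
have lc : log_concave (nth 0 p).
  apply: real_rooted_log_concave => [k|x x0].
    by rewrite pE; apply: sumr_ge0.
  have := st (fun=> x) (fun=> x0); congr (_ != 0).
  rewrite rmorph_sum horner_sum; apply: eq_bigr => S _.
  by rewrite rmorphM /= map_polyC map_polyXn hornerM hornerC hornerXn prodr_const.
by move=> i j ij; rewrite -!pE; apply: lc.
Qed.

End LogConcavity.

(** * Growth of the iterates of a symmetric operator *)

Section SetFunctions.
Variables (R : realType) (V : finType).
Implicit Types (f g v : {set V} -> R) (S e : {set V}) (k : nat).

Definition dot f g : R := \sum_(S : {set V}) f S * g S.

Definition restrict k f S : R := if #|S| == k then f S else 0.

Lemma dot_unit_CS v g : dot v v = 1 -> dot v g ^+ 2 <= dot g g.
Proof.
move=> v1.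
have expand (c : R) : \sum_(S : {set V}) (g S - c * v S) ^+ 2 =
    dot g g - 2 * c * dot v g + c ^+ 2 * dot v v.
  rewrite /dot !mulr_sumr -sumrB -big_split /=.
  by apply: eq_bigr => S _; ring.
have : 0 <= \sum_(S : {set V}) (g S - dot v g * v S) ^+ 2.
  by apply: sumr_ge0 => S _; apply: sqr_ge0.
by rewrite expand v1; lra.
Qed.

Lemma norm_le_sqrt_dot f S : `|f S| <= Num.sqrt (dot f f).
Proof.
rewrite -sqrtr_sqr ler_wsqrtr // /dot (bigD1 S) //= -expr2 lerDl.
by apply: sumr_ge0 => T _; rewrite -expr2 sqr_ge0.
Qed.

Lemma bernoulli (d : R) n : 0 <= d -> 1 + n%:R * d <= (1 + d) ^+ n.
Proof.
move=> d0; elim: n => [|n IH]; first by rewrite mul0r addr0 expr0.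
rewrite exprS -natr1.
have n0 : 0 <= n%:R :> R by rewrite ler0n.
have : (1 + d) * (1 + n%:R * d) <= (1 + d) * (1 + d) ^+ n by apply: ler_wpM2l => //; lra.
apply: le_trans.
have : 0 <= n%:R * d * d by rewrite !mulr_ge0.
lra.
Qed.

(** If [x > y > 0], the powers of [x / y] exceed any [K] by Bernoulli's inequality. Exponents
    [2 ^ j.+1] suit the repeated squaring in [rayleigh_pow]. *)
Lemma le_of_pow2 (x y K : R) : 0 <= x -> 0 <= y ->
  (forall j, x ^+ (2 ^ j.+1) <= K * y ^+ (2 ^ j.+1)) -> x <= y.
Proof.
move=> x0 y0 pw; rewrite leNgt; apply/negP => yx.
have [y00|y00] := eqVneq y 0.
  have := pw 0; rewrite y00 expr0n /= mulr0; apply/negP; rewrite -ltNge.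
  by apply: exprn_gt0; rewrite -y00.
have yp : 0 < y by rewrite lt_def y00.
pose d := x / y - 1.
have d0 : 0 < d by rewrite /d subr_gt0 ltr_pdivlMr ?mul1r.
have bnd j : j%:R * d <= K.
  have jle : (j <= 2 ^ j.+1)%N by rewrite (leq_trans (ltnW (ltn_expl j (ltnSn 1)))) // leq_exp2l.
  have := pw j; rewrite -ler_pdivrMr ?exprn_gt0 // -expr_div_n.
  apply: le_trans; rewrite (_ : x / y = 1 + d); last by rewrite /d; ring.
  apply: le_trans (bernoulli _ (ltW d0)).
  have : j%:R * d <= (2 ^ j.+1)%:R * d by rewrite ler_wpM2r ?ler_nat // ltW.
  lra.
have [n nK] : exists n : nat, K / d < n%:R.
  exists (Num.bound `|K / d|); apply: le_lt_trans (ler_norm _) _; exact: archi_boundP (normr_ge0 _).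
by have := bnd n; rewrite leNgt -ltr_pdivrMr // nK.
Qed.

Section Growth.
Variable M : ({set V} -> R) -> ({set V} -> R).
Hypothesis M_sym : forall f g, dot (M f) g = dot f (M g).
(** For a linear [M] this means that its matrix has nonnegative entries. *)
Hypothesis M_mono : forall f g, (forall S, `|f S| <= g S) ->
  forall S, `|M f S| <= M g S.
Hypothesis M_restrict : forall k f, M (restrict k f) = restrict k (M f).

Lemma iter_sym n f g : dot (iter n M f) g = dot f (iter n M g).
Proof. by elim: n f g => // n IH f g; rewrite iterSr IH M_sym. Qed.

Lemma iter_mono n f g : (forall S, `|f S| <= g S) ->
  forall S, `|iter n M f S| <= iter n M g S.
Proof. by move=> fg; elim: n => // n IH; apply: M_mono. Qed.

Lemma iter_restrict n k f : iter n M (restrict k f) = restrict k (iter n M f).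
Proof. by elim: n => //= n ->; rewrite M_restrict. Qed.

Lemma rank_sum_dot k f : rank_sum f k = dot (restrict k (fun=> 1)) (restrict k f).
Proof.
rewrite /rank_sum big_mkcond; apply: eq_bigr => S _.
by rewrite /restrict; case: ifP; rewrite ?mul1r ?mul0r.
Qed.

Lemma dot_iter2 n f : dot f (iter (2 * n) M f) = dot (iter n M f) (iter n M f).
Proof. by rewrite mul2n -addnn iterD iter_sym. Qed.

(** Repeated squaring: by symmetry the moment of order [2 n] is the squared norm of the [n]-th
    iterate, which by Cauchy-Schwarz is at least the square of the moment of order [n]. *)
Lemma rayleigh_pow v j : dot v v = 1 -> 0 <= dot v (M v) ->
  dot v (M v) ^+ (2 ^ j) <= dot v (iter (2 ^ j) M v).
Proof.
move=> v1 s0; elim: j => [|j IH]; first by rewrite expn0 expr1.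
rewrite expnS dot_iter2 mulnC exprM; apply: le_trans (dot_unit_CS _ v1).
by rewrite ler_sqr ?nnegrE ?exprn_ge0 //; apply: le_trans IH; rewrite exprn_ge0.
Qed.

(** A unit vector has entries of modulus at most 1, so [v] is dominated by the indicator of the
    [k]-sets, and this survives iteration. *)
Lemma rank_sum_lower k v j : dot v v = 1 -> restrict k v = v ->
  0 <= dot v (M v) ->
  dot v (M v) ^+ (2 ^ j) <= rank_sum (iter (2 ^ j) M (fun=> 1)) k.
Proof.
move=> v1 vk s0; apply: le_trans (rayleigh_pow j v1 s0) _.
rewrite rank_sum_dot -iter_restrict; apply: ler_sum => S _.
have vle T : `|v T| <= restrict k (fun=> 1) T.
  rewrite -vk /restrict; case: ifP => _; last by rewrite normr0.
  by rewrite -sqrtr1 -v1 norm_le_sqrt_dot.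
apply: le_trans (ler_norm _) _; rewrite normrM.
by apply: ler_pM => //; apply: iter_mono.
Qed.

(** The left side is the squared norm of the [n]-th iterate of the indicator of the [k]-sets;
    iterates stay supported there, so each application of [M] costs a factor [nu]. *)
Lemma rank_sum_upper k nu n : 0 <= nu ->
  (forall f, restrict k f = f -> dot (M f) (M f) <= nu * dot f f) ->
  rank_sum (iter (2 * n) M (fun=> 1)) k
    <= nu ^+ n * dot (restrict k (fun=> 1)) (restrict k (fun=> 1)).
Proof.
move=> nu0 up; rewrite rank_sum_dot -iter_restrict dot_iter2.
elim: n => [|n IH]; first by rewrite expr0 mul1r.
have fix1 : restrict k (iter n M (restrict k (fun=> 1))) = iter n M (restrict k (fun=> 1)).
  rewrite -[LHS]iter_restrict; congr (iter n M).
  by apply/funext => S; rewrite /restrict; case: (#|S| == k).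
by rewrite iterS exprS -mulrA; apply: le_trans (up _ fix1) _; rewrite ler_wpM2l.
Qed.

(** With [N = 2 ^ j.+1], the lower bounds, log-concavity and the squared upper bound bound the
    [N]-th power of the left side by [K ^+ 2 * nu ^+ N]. Letting [N] grow removes [K]. *)
Lemma growth_log_concave k v1 v2 nu :
  (forall n, log_concave (rank_sum (iter n M (fun=> 1)))) ->
  dot v1 v1 = 1 -> restrict k v1 = v1 -> 0 <= dot v1 (M v1) ->
  dot v2 v2 = 1 -> restrict k.+2 v2 = v2 -> 0 <= dot v2 (M v2) ->
  0 <= nu ->
  (forall f, restrict k.+1 f = f -> dot (M f) (M f) <= nu * dot f f) ->
  dot v1 (M v1) * dot v2 (M v2) <= nu.
Proof.
move=> lc v11 v1k s1 v21 v2k s2 nu0 up.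
set K := dot (restrict k.+1 (fun=> 1)) (restrict k.+1 (fun=> 1)).
have K0 : 0 <= K by apply: sumr_ge0 => S _; rewrite -expr2 sqr_ge0.
apply: (@le_of_pow2 _ _ (K ^+ 2)) => //; first exact: mulr_ge0.
move=> j; rewrite exprMn.
have l1 := rank_sum_lower j.+1 v11 v1k s1.
have l2 := rank_sum_lower j.+1 v21 v2k s2.
have u := rank_sum_upper (2 ^ j) nu0 up; rewrite -expnS -/K in u.
have r0 : 0 <= rank_sum (iter (2 ^ j.+1) M (fun=> 1)) k.+1.
  apply: sumr_ge0 => S _.
  have le11 (T : {set V}) : `|(1 : R)| <= 1 by rewrite normr1.
  exact: le_trans (normr_ge0 _) (iter_mono (2 ^ j.+1) le11 S).
apply: le_trans (ler_pM _ _ l1 l2) _; rewrite ?exprn_ge0 //.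
apply: le_trans (lc _ _ _ (leqnn k)) _.
apply: le_trans (ler_pM r0 r0 u u) _.
rewrite expnS mulnC exprM le_eqVlt; apply/orP; left; apply/eqP; ring.
Qed.

End Growth.
End SetFunctions.

(** * Products of edge operators *)

Section EdgeProducts.
Variables (R : realType) (V : finType) (theta : R) (w : {set V} -> R).
Implicit Types (f g v : {set V} -> R) (S e : {set V}) (k : nat) (l : seq {set V}).

Definition edge_ham e f S : R :=
  if #|S :&: e| == 1%N then theta * f S + f (symdiff S e) else 0.

Definition ham l f S : R := \sum_(e <- l) w e * edge_ham e f S.

Definition edge_step (eps : R) e f : {set V} -> R :=
  edge_op (1 + eps * w e * theta) (eps * w e) e f.

Definition edge_prod (eps : R) l f : {set V} -> R := foldr (edge_step eps) f l.

Lemma edge_stepE eps e f S :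
  edge_step eps e f S = f S + eps * w e * edge_ham e f S.
Proof. by rewrite /edge_step /edge_op /edge_ham; case: ifP => _; ring. Qed.

Lemma card_symdiffI S e : #|e| = 2%N ->
  (#|symdiff S e :&: e| == 1%N) = (#|S :&: e| == 1%N).
Proof.
move=> /eqP /cards2P[i [j [ij ->]]]; rewrite !card_setI_pair // !in_symdiff !inE.
by rewrite !eqxx orbT; case: (i \in S); case: (j \in S).
Qed.

(** Sizes agree exactly when [e] has as many elements inside [S] as outside. *)
Lemma card_symdiff S e : #|e| = 2%N ->
  (#|symdiff S e| == #|S|) = (#|S :&: e| == 1%N).
Proof.
move=> e2.
have cU : #|symdiff S e| = (#|S :\: e| + #|e :\: S|)%N.
  rewrite /symdiff cardsU (_ : _ :&: _ = finset.set0) ?cards0 ?subn0 //.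
  by apply/setP => i; rewrite !inE; case: (i \in S); case: (i \in e).
have cS := cardsID e S; have ce := cardsID S e; rewrite e2 finset.setIC in ce.
by rewrite cU -cS; apply/eqP/eqP; lia.
Qed.

Lemma edge_op_sym al be e f g : #|e| = 2%N ->
  dot (edge_op al be e f) g = dot f (edge_op al be e g).
Proof.
move=> e2; rewrite /dot.
rewrite (bigID (fun S => #|S :&: e| == 1%N)) [RHS](bigID (fun S => #|S :&: e| == 1%N)) /=.
congr (_ + _); last first.
  by apply: eq_bigr => S /negbTE h; rewrite /edge_op h.
transitivity (\sum_(S : {set V} | #|S :&: e| == 1%N) al * (f S * g S)
  + \sum_(S : {set V} | #|S :&: e| == 1%N) be * (f (symdiff S e) * g S)).
  by rewrite -big_split /=; apply: eq_bigr => S h; rewrite /edge_op h; ring.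
rewrite [X in _ + X](reindex_inj (inv_inj (symdiffK e))) /=.
rewrite (eq_bigl (fun S => #|S :&: e| == 1%N) _ (fun S => card_symdiffI S e2)).
rewrite -big_split /=; apply: eq_bigr => S h; rewrite /edge_op h symdiffK; ring.
Qed.

Lemma edge_op_restrict al be e k f : #|e| = 2%N ->
  edge_op al be e (restrict k f) = restrict k (edge_op al be e f).
Proof.
move=> e2; apply/funext => S; rewrite /edge_op /restrict.
case: ifP => h; last by [].
have /eqP -> : #|symdiff S e| == #|S| by rewrite card_symdiff.
by case: ifP => _; rewrite ?mulr0 ?addr0.
Qed.

Lemma edge_op_mono al be e f g : 0 <= al -> 0 <= be ->
  (forall S, `|f S| <= g S) -> forall S, `|edge_op al be e f S| <= edge_op al be e g S.
Proof.
move=> al0 be0 fg S; rewrite /edge_op; case: ifP => // _.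
apply: le_trans (ler_normD _ _) _; rewrite !normrM (ger0_norm al0) (ger0_norm be0).
by apply: lerD; apply: ler_wpM2l.
Qed.

Section Edges.
Variables (eps : R) (l : seq {set V}).
Hypothesis theta_bound : -1 <= theta <= 1.
Hypothesis l_card : {in l, forall e, #|e| = 2%N}.
Hypothesis w_ge0 : {in l, forall e, 0 <= w e}.
Hypothesis eps_ge0 : 0 <= eps.
Hypothesis eps_le : {in l, forall e, eps * w e <= 1}.

(** With [p = eps * w e], the bounds on [theta] give the triangle inequalities for [1],
    [1 + p * theta], [p] that stability requires. *)
Let weights e : e \in l -> [/\ 0 <= 1 + eps * w e * theta, 0 <= eps * w e,
  1 <= 1 + eps * w e * theta + eps * w e,
  1 + eps * w e * theta <= 1 + eps * w e &
  eps * w e <= 1 + (1 + eps * w e * theta)].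
Proof.
move=> el; have p0 : 0 <= eps * w e by rewrite mulr_ge0 // w_ge0.
have p1 := eps_le el; move: (eps * w e) p0 p1 => p p0 p1.
by move: theta_bound => /andP[t0 t1]; split; nra.
Qed.

Lemma edge_prod_stable f : stable f -> stable (edge_prod eps l f).
Proof.
move=> st; suff : {subset l <= l} -> stable (edge_prod eps l f) by apply.
move: {-2}l => l'; elim: l' => //= e l' IH sub.
have el : e \in l by apply: sub; rewrite mem_head.
have [? ? ? ? ?] := weights el.
apply: stable_edge_op => //; first exact: l_card.
by apply: IH => e' e'l; apply: sub; rewrite inE e'l orbT.
Qed.

Lemma edge_prod_restrict k f :
  edge_prod eps l (restrict k f) = restrict k (edge_prod eps l f).
Proof.
elim: l l_card => //= e l' IH lc; rewrite IH; last first.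
  by move=> e' e'l; apply: lc; rewrite inE e'l orbT.
by apply: edge_op_restrict; apply: lc; rewrite mem_head.
Qed.

Lemma edge_prod_mono f g : (forall S, `|f S| <= g S) ->
  forall S, `|edge_prod eps l f S| <= edge_prod eps l g S.
Proof.
move=> fg; suff : {subset l <= l} -> forall S, `|edge_prod eps l f S| <= edge_prod eps l g S by apply.
move: {-2}l => l'; elim: l' => //= e l' IH sub.
have el : e \in l by apply: sub; rewrite mem_head.
have [? ? ? ? ?] := weights el.
apply: edge_op_mono => //.
by apply: IH => e' e'l; apply: sub; rewrite inE e'l orbT.
Qed.

End Edges.

Lemma edge_prod_cat eps l1 l2 f :
  edge_prod eps (l1 ++ l2) f = edge_prod eps l1 (edge_prod eps l2 f).
Proof. exact: foldr_cat. Qed.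

(** Taking adjoints reverses the order of the symmetric factors. *)
Lemma edge_prod_sym eps l f g : {in l, forall e, #|e| = 2%N} ->
  dot (edge_prod eps l f) g = dot f (edge_prod eps (rev l) g).
Proof.
elim: l f g => //= e l IH f g lc.
rewrite edge_op_sym; last by apply: lc; rewrite mem_head.
rewrite IH; last by move=> e' e'l; apply: lc; rewrite inE e'l orbT.
by rewrite rev_cons -cats1 edge_prod_cat.
Qed.

Lemma edge_ham_bound e f (B : R) : `|theta| <= 1 -> (forall S, `|f S| <= B) ->
  forall S, `|edge_ham e f S| <= 2 * B.
Proof.
move=> t1 fB S; have B0 : 0 <= B := le_trans (normr_ge0 _) (fB S).
rewrite /edge_ham; case: ifP => _; last by rewrite normr0 mulr_ge0.
apply: le_trans (ler_normD _ _) _; rewrite normrM.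
have := fB (symdiff S e); have := ler_pM (normr_ge0 _) (normr_ge0 _) t1 (fB S).
lra.
Qed.

Lemma ham_bound l f (B : R) : `|theta| <= 1 -> (forall S, `|f S| <= B) ->
  forall S, `|ham l f S| <= (\sum_(e <- l) 2 * `|w e|) * B.
Proof.
move=> t1 fB S; apply: le_trans (ler_norm_sum _ _ _) _.
rewrite mulr_suml; apply: ler_sum => e _; rewrite normrM.
rewrite [2 * _]mulrC -mulrA; apply: ler_wpM2l => //; exact: edge_ham_bound.
Qed.

(** A first-order expansion whose constant depends on neither [eps] nor [f]. Adding an edge brings
    one new error, [eps * w e] times [edge_ham e] of the change [g - f] made by the other edges,
    which is itself of order [eps]. *)
Lemma edge_prod_expansion l : `|theta| <= 1 -> exists2 C : R, 0 <= C &
  forall eps f (B : R), 0 <= eps <= 1 -> (forall S, `|f S| <= B) ->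
  forall S, `|edge_prod eps l f S - f S - eps * ham l f S| <= C * eps ^+ 2 * B.
Proof.
move=> t1; elim: l => [|e l [C C0 IH]].
  exists 0 => // eps f B _ fB S.
  by rewrite /ham big_nil mulr0 subr0 subrr normr0 !mul0r.
set D := \sum_(e <- l) 2 * `|w e|.
have D0 : 0 <= D by apply: sumr_ge0 => i _; rewrite mulr_ge0.
exists (C + 2 * `|w e| * (D + C)).
  by rewrite addr_ge0 // !mulr_ge0 // addr_ge0.
move=> eps f B epsb fB S; have /andP[e0 e1] := epsb.
have B0 : 0 <= B := le_trans (normr_ge0 _) (fB S).
pose g := edge_prod eps l f.
have gf T : `|g T - f T| <= eps * (D + C) * B.
  have -> : g T - f T = (g T - f T - eps * ham l f T) + eps * ham l f T by ring.
  apply: le_trans (ler_normD _ _) _; rewrite normrM (ger0_norm e0).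
  have h1 := IH eps f B epsb fB T.
  have h2 : eps * `|ham l f T| <= eps * (D * B) by apply: ler_wpM2l => //; apply: ham_bound.
  have h3 : C * eps ^+ 2 * B <= C * eps * B.
    apply: ler_wpM2r => //; apply: ler_wpM2l => //; rewrite expr2; nra.
  apply: le_trans (lerD h1 h2) _; lra.
rewrite /= -/(edge_prod eps l f) -/g edge_stepE.
have hamE : edge_ham e g S - edge_ham e f S = edge_ham e (fun T => g T - f T) S.
  by rewrite /edge_ham; case: ifP => _; ring.
have -> : g S + eps * w e * edge_ham e g S - f S - eps * ham (e :: l) f S =
    (g S - f S - eps * ham l f S) + eps * w e * edge_ham e (fun T => g T - f T) S.
  by rewrite -hamE /ham big_cons; ring.
apply: le_trans (ler_normD _ _) _.
have h1 := IH eps f B epsb fB S.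
have h2 := edge_ham_bound e t1 gf S.
have h3 : `|eps * w e * edge_ham e (fun T => g T - f T) S|
    <= eps * `|w e| * (2 * (eps * (D + C) * B)).
  by rewrite !normrM (ger0_norm e0); apply: ler_wpM2l; rewrite ?mulr_ge0.
apply: le_trans (lerD h1 h3) _; lra.
Qed.

End EdgeProducts.

(** * The largest eigenvalue of a symmetric matrix *)

Section LargestEigenvalue.
Variables (R : realType) (N : nat).
Implicit Types (A M : 'M[R]_N) (x y v : 'rV[R]_N).

Definition form M x y : R := (x *m M *m y^T) 0 0.

Lemma formE M x y : form M x y = \sum_i \sum_j x 0 i * M i j * y 0 j.
Proof.
rewrite /form mxE exchange_big /=; apply: eq_bigr => j _.
by rewrite !mxE mulr_suml.
Qed.

Lemma form1 x : form 1%:M x x = \sum_i x 0 i ^+ 2.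
Proof. by rewrite /form mulmx1 mxE; apply: eq_bigr => i _; rewrite mxE expr2. Qed.

Lemma form1_ge0 x : 0 <= form 1%:M x x.
Proof. by rewrite form1 sumr_ge0 // => i _; apply: sqr_ge0. Qed.

Lemma form1_gt0 x : x != 0 -> 0 < form 1%:M x x.
Proof.
move=> x0; rewrite lt_def form1_ge0 andbT; apply: contra x0 => /eqP.
rewrite form1 => /psumr_eq0P h; apply/eqP/rowP => i; rewrite mxE.
by apply/eqP; rewrite -sqrf_eq0 h // => j _; apply: sqr_ge0.
Qed.

Lemma formC A x y : A^T = A -> form A x y = form A y x.
Proof.
move=> As; have tr1 (z : 'M[R]_1) : z^T 0 0 = z 0 0 by rewrite mxE.
by rewrite /form -[RHS]tr1 !trmx_mul trmxK As mulmxA.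
Qed.

Lemma form_bound M x : form M x x <= (\sum_i \sum_j `|M i j|) * form 1%:M x x.
Proof.
rewrite formE mulr_suml; apply: ler_sum => i _.
rewrite mulr_suml; apply: ler_sum => j _.
have sq k : x 0 k ^+ 2 <= form 1%:M x x.
  rewrite form1 (bigD1 k) //= lerDl; apply: sumr_ge0 => ? _; exact: sqr_ge0.
have h : `|x 0 i * x 0 j| <= form 1%:M x x.
  rewrite ler_norml; have := sq i; have := sq j.
  have := sqr_ge0 (x 0 i + x 0 j); have := sqr_ge0 (x 0 i - x 0 j).
  by move=> *; apply/andP; split; nra.
apply: le_trans (ler_norm _) _; rewrite mulrAC normrM mulrC.
exact: ler_wpM2l.
Qed.

Lemma form_eigenvector A v a : v *m A = a *: v -> form A v v = a * form 1%:M v v.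
Proof. by move=> vA; rewrite /form vA mulmx1 -scalemxAl mxE. Qed.

Lemma formBl M x y v : form M (x - y) v = form M x v - form M y v.
Proof. by rewrite /form !mulmxBl !mxE. Qed.

Lemma formZl M a x v : form M (a *: x) v = a * form M x v.
Proof. by rewrite /form -!scalemxAl mxE. Qed.

Lemma formBr M x y v : form M v (x - y) = form M v x - form M v y.
Proof. by rewrite /form linearB /= mulmxBr !mxE. Qed.

Lemma formZr M a x v : form M v (a *: x) = a * form M v x.
Proof. by rewrite /form linearZ /= -scalemxAr mxE. Qed.

Lemma formZ M x (n : R) : 0 <= n ->
  form M ((Num.sqrt n)^-1 *: x) ((Num.sqrt n)^-1 *: x) = form M x x / n.
Proof.
by move=> n0; rewrite formZl formZr mulrA -expr2 exprVn sqr_sqrtr // mulrC.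
Qed.

Definition rayleigh_values A : set R :=
  [set a | exists2 x, form 1%:M x x = 1 & form A x x = a]%classic.

Hypothesis N_gt0 : (0 < N)%N.

Lemma rayleigh_has_sup A : has_sup (rayleigh_values A).
Proof.
split.
  pose x : 'rV[R]_N := delta_mx 0 (Ordinal N_gt0).
  exists (form A x x); exists x => //.
  rewrite form1 (bigD1 (Ordinal N_gt0)) //= big1 => [|i /negbTE i0].
    by rewrite mxE !eqxx expr1n addr0.
  by rewrite mxE i0 andbF expr0n.
exists (\sum_i \sum_j `|A i j|) => _ [x x1 <-].
by have := form_bound A x; rewrite x1 mulr1.
Qed.

Let rho A := sup (rayleigh_values A).

Lemma form_le_sup A x : form A x x <= rho A * form 1%:M x x.
Proof.
have [->|x0] := eqVneq x 0; first by rewrite /form !mul0mx mxE mulr0.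
have n0 := form1_gt0 x0; set n := form _ _ _ in n0 *.
rewrite -ler_pdivrMr // -formZ ?(ltW n0) //.
apply: sup_upper_bound; first exact: rayleigh_has_sup.
by exists ((Num.sqrt n)^-1 *: x) => //; rewrite formZ ?(ltW n0) // divff // gt_eqF.
Qed.

(* If [rho - A] were invertible, it would be bounded below by a positive
   multiple of the identity, and [rho] could not be the supremum. *)
Lemma sup_rayleigh_singular A : A^T = A -> (rho A)%:M - A \notin unitmx.
Proof.
move=> As; apply/negP => Pu; set P := _ - A in Pu.
have Ps : P^T = P by rewrite /P linearB /= tr_scalar_mx As.
have formP x : form P x x = rho A * form 1%:M x x - form A x x.
  by rewrite /form /P mulmxBr mulmxBl mul_mx_scalar mulmx1 -scalemxAl !mxE.
have Ppos x : 0 <= form P x x by rewrite formP subr_ge0 form_le_sup.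
pose K := 1 + \sum_i \sum_j `|P i j|.
have K0 : 0 < K.
  by rewrite /K ltr_wpDr // !sumr_ge0 // => i _; rewrite sumr_ge0.
pose Q := invmx P; pose L := 1 + \sum_i \sum_j `|(Q *m Q^T) i j|.
have L0 : 0 < L.
  by rewrite /L ltr_wpDr // !sumr_ge0 // => i _; rewrite sumr_ge0.
have lower x : form 1%:M x x <= L * (K * form P x x).
  set y := x *m P.
  have xE : x = y *m Q by rewrite /y /Q mulmxK.
  have xy : form P x y = form 1%:M y y by rewrite /form mulmx1.
  have n1 : form 1%:M x x <= L * form 1%:M y y.
    rewrite (_ : form 1%:M x x = form (Q *m Q^T) y y); last first.
      by rewrite /form mulmx1 {1 2}xE trmx_mul !mulmxA.
    have := form_bound (Q *m Q^T) y; have := form1_ge0 y; rewrite /L mulrDl; lra.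
  apply: le_trans n1 _; apply: ler_wpM2l; first exact: ltW.
  have yy : form P y y <= K * form 1%:M y y.
    have := form_bound P y; have := form1_ge0 y; rewrite /K mulrDl; lra.
  (* Positivity at [K x - y] and [form P y y <= K |y|^2] give [|y|^2 <= K * form P x x], as
     [form P x y = |y|^2]. *)
  have := Ppos (K *: x - y).
  have -> : form P (K *: x - y) (K *: x - y) =
      K ^+ 2 * form P x x - 2 * K * form P x y + form P y y.
    have -> : form P (K *: x - y) (K *: x - y) =
        K ^+ 2 * form P x x - K * form P x y - K * form P y x + form P y y.
      by rewrite formBl !formBr !formZl !formZr; ring.
    by rewrite (formC y x Ps); ring.
  rewrite xy => h.
  have : 0 <= K * (K * form P x x - form 1%:M y y) by lra.
  by rewrite pmulr_rge0 // subr_ge0.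
have LK : 0 < (L * K)^-1 by rewrite invr_gt0 mulr_gt0.
have [a [x x1 <-]] := sup_adherent LK (rayleigh_has_sup A).
apply/negP; rewrite -leNgt lerBrDl -lerBrDr -/(rho A).
have := lower x; rewrite formP x1 mulr1 mulrA mulrC -ler_pdivrMr ?mulr_gt0 //.
by rewrite div1r; lra.
Qed.

(** Singularity of [rho - A] makes [rho] an eigenvalue; evaluating the form at eigenvectors shows
    that no eigenvalue exceeds it. *)
Lemma lambda_max_sup A : A^T = A ->
  lambda_max A = rho A /\ eigenvalue A (rho A).
Proof.
move=> As.
have ev : eigenvalue A (rho A).
  rewrite /eigenvalue /eigenspace kermx_eq0 row_free_unit -opprB -scaleN1r.
  by rewrite unitmxZ ?unitrN1 // sup_rayleigh_singular.
split=> //; apply/eqP; rewrite eq_le; apply/andP; split.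
  apply: ge_sup; first by exists (rho A).
  move=> a /eigenvalueP[v vA v0].
  by have := form_le_sup A v; rewrite (form_eigenvector vA) ler_pM2r ?form1_gt0.
apply: ub_le_sup => //; exists (rho A) => a /eigenvalueP[v vA v0].
by have := form_le_sup A v; rewrite (form_eigenvector vA) ler_pM2r ?form1_gt0.
Qed.

Lemma form_le_lambda_max A x : A^T = A ->
  form A x x <= lambda_max A * form 1%:M x x.
Proof. by move=> /lambda_max_sup[-> _]; apply: form_le_sup. Qed.

Lemma lambda_max_eigenvector A : A^T = A -> exists2 v,
  form 1%:M v v = 1 & form A v v = lambda_max A.
Proof.
move=> /lambda_max_sup[-> /eigenvalueP[v vA v0]].
have n0 := form1_gt0 v0; set n := form _ _ _ in n0 *.
exists ((Num.sqrt n)^-1 *: v); first by rewrite formZ ?(ltW n0) // divff // gt_eqF.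
by rewrite formZ ?(ltW n0) // (form_eigenvector vA) mulfK // gt_eqF.
Qed.

End LargestEigenvalue.

(** * Token matrices as operators on set functions *)

Section TokenMatrix.
Variables (R : realType) (V : finType) (E : {set {set V}}) (w : {set V} -> R).
Variable theta : R.
Implicit Types (f g v : {set V} -> R) (S T e : {set V}) (k : nat).
Hypothesis card_edge : forall e, e \in E -> #|e| = 2%N.

Let kernel S T : R :=
  (if symdiff S T \in E then w (symdiff S T) else 0)
  + theta * (token_degree E w S *+ (S == T)).

Let token_mx k := token_adj E w k + theta *: token_deg E w k.

Let token_mxE k i j : token_mx k i j = kernel (enum_val i) (enum_val j).
Proof. by rewrite !mxE /kernel (inj_eq enum_val_inj) eq_sym. Qed.

Lemma symdiffC S T : symdiff S T = symdiff T S.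
Proof. by apply/setP => i; rewrite !in_symdiff addbC. Qed.

Let token_mx_sym k : (token_mx k)^T = token_mx k.
Proof.
apply/matrixP => i j; rewrite mxE !token_mxE /kernel symdiffC; congr (_ + _ * _).
by case: (eqVneq (enum_val j) (enum_val i)) => [->|/negbTE h]; rewrite ?eqxx // eq_sym h.
Qed.

Let kernel_ham k f S : #|S| = k ->
  \sum_(T in token_sets V k) kernel S T * f T = ham theta w (enum E) f S.
Proof.
move=> Sk; rewrite /ham big_enum /=.
under eq_bigr do rewrite mulrDl.
rewrite big_split /=.
have -> : \sum_(T in token_sets V k) theta * (token_degree E w S *+ (S == T)) * f T
    = \sum_(e in E | #|S :&: e| == 1%N) w e * (theta * f S).
  rewrite (bigD1 S) /=; last by rewrite inE Sk.
  rewrite big1 => [|T /andP[_ /negbTE TS]]; last by rewrite eq_sym TS mulr0n mulr0 mul0r.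
  by rewrite eqxx mulr1n addr0 /token_degree -mulr_suml; ring.
have -> : \sum_(T in token_sets V k)
      (if symdiff S T \in E then w (symdiff S T) else 0) * f T
    = \sum_(e in E | #|S :&: e| == 1%N) w e * f (symdiff S e).
  (* Substituting [T = symdiff e S] turns the sum over [k]-sets into one over edges; [T] has size
     [k] exactly when [e] meets [S] in one point. *)
  rewrite (reindex_inj (inv_inj (symdiffK S))) /=.
  rewrite [LHS]big_mkcond [RHS]big_mkcond; apply: eq_bigr => e _.
  rewrite (symdiffC S (symdiff e S)) symdiffK inE -Sk (symdiffC e S).
  have [eE|eE] := boolP (e \in E); last by rewrite mul0r if_same.
  by rewrite card_symdiff //; exact: card_edge.
rewrite -big_split /= [LHS]big_mkcondr /=; apply: eq_bigr => e eE.
by rewrite /edge_ham; case: ifP => _; [ring | rewrite mulr0].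
Qed.

Let vec k f : 'rV[R]_#|token_sets V k| := \row_i f (enum_val i).

Let dot_vec k f g : restrict k f = f ->
  dot f g = \sum_(i < #|token_sets V k|) f (enum_val i) * g (enum_val i).
Proof.
move=> fk; rewrite -(big_enum_val (fun S => f S * g S)).
rewrite [RHS]big_mkcond; apply: eq_bigr => S _.
by rewrite inE -fk /restrict; case: ifP => //; rewrite mul0r.
Qed.

Let form1_vec k f : restrict k f = f -> form 1%:M (vec k f) (vec k f) = dot f f.
Proof.
by move=> fk; rewrite form1 (dot_vec _ fk); apply: eq_bigr => i _; rewrite mxE expr2.
Qed.

Let form_vec k f : restrict k f = f ->
  form (token_mx k) (vec k f) (vec k f) = dot f (ham theta w (enum E) f).
Proof.
move=> fk; rewrite formE (dot_vec _ fk); apply: eq_bigr => i _.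
rewrite -(kernel_ham (k := k)); last by apply/eqP; have := enum_valP i; rewrite inE.
rewrite [in RHS]big_enum_val mulr_sumr; apply: eq_bigr => j _.
by rewrite token_mxE !mxE mulrA.
Qed.

Let token_sets_gt0 k : (k <= #|V|)%N -> (0 < #|token_sets V k|)%N.
Proof. by move=> kn; rewrite card_draws bin_gt0. Qed.

Lemma token_rayleigh k f : (k <= #|V|)%N -> restrict k f = f ->
  dot f (ham theta w (enum E) f) <= token_lambda_max E w theta k * dot f f.
Proof.
move=> kn fk; rewrite -(form_vec fk) -(form1_vec fk).
by apply: form_le_lambda_max; [exact: token_sets_gt0 | exact: token_mx_sym].
Qed.

Lemma token_eigenfunction k : (k <= #|V|)%N -> exists v,
  [/\ restrict k v = v, dot v v = 1 &
      dot v (ham theta w (enum E) v) = token_lambda_max E w theta k].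
Proof.
move=> kn; have [x x1 xh] := lambda_max_eigenvector (token_sets_gt0 kn) (token_mx_sym k).
(* The eigenvector, extended by zero to the subsets of other sizes. *)
pose v S := \sum_i x 0 i *+ (enum_val i == S).
have vE : vec k v = x.
  apply/rowP => i; rewrite mxE /v (bigD1 i) //= eqxx big1 ?addr0 // => j ji.
  by rewrite (inj_eq enum_val_inj) (negbTE ji).
have vk : restrict k v = v.
  apply/funext => S; rewrite /restrict; case: ifP => // /negbT Sk.
  rewrite /v big1 // => i _; case: eqP => // iS.
  by have := enum_valP i; rewrite inE iS (negbTE Sk).
by exists v; rewrite -(form1_vec vk) -(form_vec vk) vE.
Qed.

(** Complementation exchanges the two states with one token on [e] and commutes with sliding along
    [e]. *)
Lemma ham_setC l f S : {in l, forall e, #|e| = 2%N} ->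
  ham theta w l (fun T => f (~: T)) S = ham theta w l f (~: S).
Proof.
move=> lc; rewrite /ham !big_seq; apply: eq_bigr => e /lc e2; congr (_ * _).
have -> : edge_ham theta e f (~: S) =
    if #|S :&: e| == 1%N then theta * f (~: S) + f (symdiff (~: S) e) else 0.
  rewrite /edge_ham; congr (if _ then _ else _).
  move: e2 => /eqP/cards2P[i [j [ij ->]]]; rewrite !card_setI_pair // !inE.
  by case: (i \in S); case: (j \in S).
rewrite /edge_ham; case: ifP => // _; congr (_ + f _).
by apply/setP => i; rewrite !(inE, in_symdiff); case: (i \in S); case: (i \in e).
Qed.

Lemma dot_setC f g : dot (fun S => f (~: S)) (fun S => g (~: S)) = dot f g.
Proof. by rewrite /dot [RHS](reindex_inj (inv_inj (@finset.setCK V))). Qed.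

(** A maximiser on [k]-sets, composed with complementation, is a test function on the complementary
    rank. *)
Lemma token_lambda_max_le_setC k : (k <= #|V|)%N ->
  token_lambda_max E w theta k <= token_lambda_max E w theta (#|V| - k).
Proof.
move=> kn; have [v [vk v1 <-]] := token_eigenfunction kn.
have enum_card : {in enum E, forall e, #|e| = 2%N}.
  by move=> e; rewrite mem_enum; apply: card_edge.
rewrite -dot_setC -[leRHS]mulr1 -v1 -(dot_setC v v).
have -> : (fun S => ham theta w (enum E) v (~: S)) = ham theta w (enum E) (fun S => v (~: S)).
  by apply/funext => S; rewrite ham_setC.
apply: token_rayleigh; first exact: leq_subr.
apply/funext => S; rewrite /restrict; case: ifP => // /negbT Sk.
rewrite -vk /restrict; case: ifP => // /eqP cS.
by have := cardsC S; move: Sk kn; rewrite cS; lia.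
Qed.

End TokenMatrix.

(** * Concavity *)

(** Compares the coefficients of [eps], the constant terms being equal. *)
Lemma first_order_le (R : realType) (h1 h2 h c K eps0 : R) :
  0 <= c -> 0 <= K -> 0 < eps0 ->
  (forall eps, 0 < eps <= eps0 ->
     (1 + 2 * eps * h1 - eps ^+ 2 * c) * (1 + 2 * eps * h2 - eps ^+ 2 * c)
     <= 1 + 4 * eps * h + eps ^+ 2 * K) ->
  h1 + h2 <= 2 * h.
Proof.
move=> c0 K0 e0 ineq; rewrite leNgt; apply/negP => lt.
pose g := h1 + h2 - 2 * h; have g0 : 0 < g by rewrite /g; lra.
(* For [eps <= 1] the hypothesis yields [2 * g <= eps * L], while [eps * (L + 1) <= g]; this
   contradicts [g > 0]. *)
pose L := K + 2 * c + 4 * `|h1 * h2| + 2 * c * `|h1 + h2|.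
have L0 : 0 <= L by rewrite /L !addr_ge0 ?mulr_ge0.
pose eps := Num.min eps0 (Num.min 1 (g / (L + 1))).
have epos : 0 < eps by rewrite /eps !lt_min e0 ltr01 divr_gt0 //; lra.
have ee0 : eps <= eps0 by rewrite /eps ge_min lexx.
have e1 : eps <= 1 by rewrite /eps !ge_min lexx orbT.
have eg : eps * (L + 1) <= g.
  by rewrite -ler_pdivlMr; [rewrite /eps !ge_min lexx !orbT | lra].
have := ineq eps; rewrite epos ee0 => /(_ isT) {}ineq.
have h12 := ler_norm (h1 * h2); have h12' := ler_norm (- (h1 * h2)).
have s12 := ler_norm (h1 + h2).
rewrite normrN in h12'.
have m1 : eps ^+ 2 * (- 4 * (h1 * h2)) <= eps ^+ 2 * (4 * `|h1 * h2|).
  by apply: ler_wpM2l; [exact: sqr_ge0 | lra].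
have m2 : eps ^+ 2 * (2 * eps * c * (h1 + h2)) <= eps ^+ 2 * (2 * c * `|h1 + h2|).
  apply: ler_wpM2l; first exact: sqr_ge0.
  apply: (@le_trans _ _ (2 * eps * c * `|h1 + h2|)).
    by apply: ler_wpM2l => //; rewrite !mulr_ge0 // ltW.
  apply: ler_wpM2r => //; apply: ler_wpM2r => //; lra.
have m3 : 0 <= eps ^+ 4 * c ^+ 2 by rewrite mulr_ge0 ?sqr_ge0 // exprn_ge0 // ltW.
have main : eps * (2 * g) <= eps * (eps * L) by rewrite /g /L; nra.
rewrite ler_pM2l // in main; nra.
Qed.

Lemma square_expansion_le (R : realType) (y x H eps B C D : R) :
  0 <= eps <= 1 -> 0 <= B -> 0 <= C -> 0 <= D ->
  `|x| <= B -> `|H| <= D * B -> `|y - x - eps * H| <= C * eps ^+ 2 * B ->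
  y * y <= x * x + 2 * eps * (x * H)
           + eps ^+ 2 * ((D ^+ 2 + 2 * (1 + D) * C + C ^+ 2) * B ^+ 2).
Proof.
move=> /andP[e0 e1] B0 C0 D0 xB HB; set r := y - x - eps * H => rB.
have -> : y * y = x * x + 2 * eps * (x * H)
    + (eps ^+ 2 * H ^+ 2 + 2 * (r * (x + eps * H)) + r ^+ 2) by rewrite /r; ring.
have sq0 : 0 <= eps ^+ 2 by apply: sqr_ge0.
have DB0 : 0 <= D * B by apply: mulr_ge0.
have H2 : eps ^+ 2 * H ^+ 2 <= eps ^+ 2 * (D * B) ^+ 2.
  by apply: ler_wpM2l => //; rewrite -real_normK ?num_real // lerXn2r ?nnegrE.
have xH : `|x + eps * H| <= B + D * B.
  apply: le_trans (ler_normD _ _) _; apply: lerD => //.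
  rewrite normrM (ger0_norm e0); apply: le_trans HB.
  by rewrite ler_piMl.
have rx : r * (x + eps * H) <= C * eps ^+ 2 * B * (B + D * B).
  by apply: le_trans (ler_norm _) _; rewrite normrM; apply: ler_pM.
(* One power of [eps] is given up so that [r ^+ 2] also gets a bound of order [eps ^+ 2]. *)
have rC : C * eps ^+ 2 * B <= C * eps * B.
  apply: ler_wpM2r => //; apply: ler_wpM2l => //.
  by rewrite expr2 ler_piMl.
have r2 : r ^+ 2 <= (C * eps * B) ^+ 2.
  rewrite -real_normK ?num_real // lerXn2r ?nnegrE //; last exact: le_trans rC.
  by rewrite !mulr_ge0.
have -> : eps ^+ 2 * ((D ^+ 2 + 2 * (1 + D) * C + C ^+ 2) * B ^+ 2) =
  eps ^+ 2 * (D * B) ^+ 2 + 2 * (C * eps ^+ 2 * B * (B + D * B)) + (C * eps * B) ^+ 2 by ring.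
lra.
Qed.

Section Concavity.
Variables (R : realType) (V : finType) (E : {set {set V}}) (w : {set V} -> R).
Variable theta : R.
Implicit Types (f g v : {set V} -> R) (S T e : {set V}) (k : nat).
Hypothesis card_edge : forall e, e \in E -> #|e| = 2%N.
Hypothesis w_ge0 : forall e, e \in E -> 0 <= w e.
Hypothesis theta_bound : -1 <= theta <= 1.

Let h k := token_lambda_max E w theta k.
(* A palindrome, so that the product of edge operators along it is symmetric. *)
Let l := enum E ++ rev (enum E).

Let mem_l e : (e \in l) = (e \in E).
Proof. by rewrite mem_cat mem_rev mem_enum orbb. Qed.

Let rev_l : rev l = l.
Proof. by rewrite rev_cat revK. Qed.

Let ham_l f S : ham theta w l f S = 2 * ham theta w (enum E) f S.
Proof.
rewrite /ham big_cat /= [X in _ + X](perm_big (enum E)) ?perm_rev //=; ring.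
Qed.

Let dot_ham_l f : dot f (ham theta w l f) = 2 * dot f (ham theta w (enum E) f).
Proof.
rewrite /dot mulr_sumr; apply: eq_bigr => S _; rewrite ham_l; ring.
Qed.

Let n2 : R := #|{set V}|%:R.

Lemma token_lambda_max_concave k : (k.+2 <= #|V|)%N -> h k + h k.+2 <= 2 * h k.+1.
Proof.
move=> kn.
have t1 : `|theta| <= 1 by rewrite ler_norml.
have [C C0 expansion] := edge_prod_expansion w l t1.
have [v1 [v1k v11 v1h]] := token_eigenfunction w theta card_edge (ltnW (ltnW kn)).
have [v2 [v2k v21 v2h]] := token_eigenfunction w theta card_edge kn.
pose D := \sum_(e <- l) 2 * `|w e|.
have D0 : 0 <= D by apply: sumr_ge0 => e _; rewrite mulr_ge0.
have n20 : 0 <= n2 by apply: ler0n.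
pose c := C * n2; have c0 : 0 <= c by rewrite mulr_ge0.
pose K := n2 * (D ^+ 2 + 2 * (1 + D) * C + C ^+ 2).
have K0 : 0 <= K.
  by rewrite mulr_ge0 // !addr_ge0 ?sqr_ge0 // !mulr_ge0 // addr_ge0.
(* [m] dominates every constant in play, so [eps <= (4 * m)^-1] makes each product with [eps] at
   most 1/4. This yields [eps * w e <= 1] and the nonnegativity of the Rayleigh bounds and of
   [nu]. *)
pose m := 1 + `|h k| + `|h k.+1| + `|h k.+2| + c + D.
have m1 : 1 <= m by rewrite /m; have := normr_ge0 (h k); have := normr_ge0 (h k.+1);
  have := normr_ge0 (h k.+2); lra.
have m0 : 0 < 4 * m by lra.
apply: (@first_order_le _ _ _ _ c K (4 * m)^-1) => //; first by rewrite invr_gt0.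
move=> eps /andP[e0 em].
have epsm : eps * m <= 4^-1.
  move: em; rewrite -[(4 * m)^-1]mul1r ler_pdivlMr // => em; lra.
have e1 : eps <= 1 by nra.
have small a : 0 <= a -> a <= m -> eps * a <= 4^-1.
  by move=> a0 am; apply: le_trans epsm; rewrite ler_pM2l.
have eps01 : 0 <= eps <= 1 by rewrite ltW.
have hsmall a : `|a| <= m -> `|eps * a| <= 4^-1.
  by move=> am; rewrite normrM (gtr0_norm e0) small.
have norms : [/\ `|h k| <= m, `|h k.+1| <= m, `|h k.+2| <= m, c <= m & D <= m].
  rewrite /m; have := normr_ge0 (h k); have := normr_ge0 (h k.+1).
  by have := normr_ge0 (h k.+2) => *; split; lra.
have [nk nk1 nk2 nc nD] := norms.
have eps_c : eps ^+ 2 * c <= 4^-1.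
  have := small _ c0 nc; have : 0 <= eps * c by rewrite mulr_ge0 // ltW.
  by rewrite expr2 -mulrA => ? ?; nra.
have l_card : {in l, forall e, #|e| = 2%N} by move=> e; rewrite mem_l; apply: card_edge.
have l_w : {in l, forall e, 0 <= w e} by move=> e; rewrite mem_l; apply: w_ge0.
have l_eps : {in l, forall e, eps * w e <= 1}.
  move=> e el; have we0 := l_w e el.
  have wD : w e <= D.
    apply: (@le_trans _ _ (2 * `|w e|)); first by rewrite ger0_norm //; lra.
    by rewrite /D (big_rem e) //= lerDl sumr_ge0 // => e' _; rewrite mulr_ge0.
  by have := small _ we0 (le_trans wD nD); lra.
pose M := edge_prod theta w eps l.
(* The palindrome contains each edge twice, hence [2 * eps]; the pointwise errors are summed over
   all [n2] subsets. *)
have lower v a : dot v v = 1 -> dot v (ham theta w (enum E) v) = a ->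
    1 + 2 * eps * a - eps ^+ 2 * c <= dot v (M v).
  move=> vv va.
  have vb S : `|v S| <= 1 by rewrite -sqrtr1 -vv norm_le_sqrt_dot.
  have -> : 1 + 2 * eps * a = dot v (fun S => v S + eps * ham theta w l v S).
    have -> : 2 * eps * a = dot v (ham theta w l v) * eps by rewrite dot_ham_l va; ring.
    rewrite -vv /dot mulr_suml -big_split /=.
    by apply: eq_bigr => S _; ring.
  rewrite lerBlDr -lerBlDl /dot -sumrB /c /n2 -sum1_card natr_sum !mulr_sumr.
  apply: ler_sum => S _; rewrite mulr1 -mulrBr.
  apply: le_trans (ler_norm _) _; rewrite normrM -[leRHS]mul1r.
  apply: ler_pM => //; rewrite distrC opprD addrA.
  by apply: le_trans (expansion eps v 1 eps01 vb S) _; rewrite mulr1 mulrC.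
(* The factor 4 comes from squaring an operator with first-order term [2 * eps]. *)
have upper f : restrict k.+1 f = f ->
    dot (M f) (M f) <= (1 + 4 * eps * h k.+1 + eps ^+ 2 * K) * dot f f.
  move=> fk; set F := dot f f.
  have F0 : 0 <= F by apply: sumr_ge0 => S _; rewrite -expr2 sqr_ge0.
  set B := Num.sqrt F; have B0 : 0 <= B by apply: sqrtr_ge0.
  have BB : B ^+ 2 = F by rewrite sqr_sqrtr.
  have fB S : `|f S| <= B by apply: norm_le_sqrt_dot.
  have term S : M f S * M f S <= f S * f S + 2 * eps * (f S * ham theta w l f S)
      + eps ^+ 2 * ((D ^+ 2 + 2 * (1 + D) * C + C ^+ 2) * B ^+ 2).
    have Hb := ham_bound w l t1 fB S; rewrite -/D in Hb.
    have rb := expansion eps f B eps01 fB S.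
    exact: square_expansion_le.
  rewrite BB in term; apply: le_trans (ler_sum _ (fun S _ => term S)) _.
  rewrite !big_split /= -[X in _ + X + _]mulr_sumr -/(dot f f) -/F.
  rewrite -/(dot f (ham theta w l f)) dot_ham_l sumr_const.
  have := token_rayleigh w theta card_edge (ltnW kn) fk; rewrite -/F -/(h k.+1) => hr.
  have : 4 * eps * dot f (ham theta w (enum E) f) <= 4 * eps * (h k.+1 * F).
    by apply: ler_wpM2l => //; lra.
  rewrite /K /n2 -mulr_natr; lra.
have nu0 : 0 <= 1 + 4 * eps * h k.+1 + eps ^+ 2 * K.
  have := hsmall _ nk1; rewrite ler_norml => /andP[? _].
  have : 0 <= eps ^+ 2 * K by rewrite mulr_ge0 ?sqr_ge0.
  by lra.
have pos a : `|a| <= m -> 0 <= 1 + 2 * eps * a - eps ^+ 2 * c.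
  by move=> /hsmall; rewrite ler_norml => /andP[? _]; lra.
have l1 := lower _ _ v11 v1h; have l2 := lower _ _ v21 v2h.
apply: le_trans (ler_pM (pos _ nk) (pos _ nk2) l1 l2) _.
have M_mono f g : (forall S, `|f S| <= g S) -> forall S, `|M f S| <= M g S.
  by move=> fg S; apply: edge_prod_mono => //; apply: ltW.
apply: growth_log_concave nu0 upper => //.
- by move=> f g; rewrite /M edge_prod_sym ?rev_l.
- move=> k' f; exact: edge_prod_restrict.
(* Nonnegativity and stability both pass from each iterate to the next. *)
- move=> n; have : (forall S, 0 <= iter n M (fun=> 1) S) /\ stable (iter n M (fun=> 1)).
    elim: n => [|n [IH1 IH2]]; first by split=> [S|]; [exact: ler01 | exact: stable_const1].
    split; last by apply: edge_prod_stable => //; apply: ltW.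
    have IH T : `|iter n M (fun=> 1) T| <= iter n M (fun=> 1) T by rewrite ger0_norm.
    by move=> S; apply: le_trans (normr_ge0 _) (M_mono _ _ IH S).
  by case; apply: rank_sum_log_concave.
- exact: le_trans (pos _ nk) l1.
- exact: le_trans (pos _ nk2) l2.
Qed.

End Concavity.

Theorem theorem1p1 (R : realType) (V : finType) (n : nat)
    (E : {set {set V}}) (w : {set V} -> R) (theta : R)
    (cardV : #|V| = n)
    (card_edge : forall e : {set V}, e \in E -> #|e| = 2%N)
    (w_ge0 : forall e : {set V}, e \in E -> 0 <= w e)
    (theta_ge : -1 <= theta) (theta_le : theta <= 1) :
  let h := token_lambda_max E w theta in
  [/\ forall k : nat, (1 <= k)%N -> (k <= n - 1)%N ->
        2 * h k >= h (k - 1)%N + h (k + 1)%N,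
      forall k : nat, (k <= n)%N -> h k = h (n - k)%N
    & forall k : nat, (2 * k < n)%N -> h k <= h (k + 1)%N].
Proof.
move=> h; have theta_bound : -1 <= theta <= 1 by rewrite theta_ge.
have concave k : (k.+2 <= n)%N -> h k + h k.+2 <= 2 * h k.+1.
  by rewrite -cardV; apply: token_lambda_max_concave.
have symm k : (k <= n)%N -> h k = h (n - k)%N.
  move=> kn; apply/eqP; rewrite eq_le -{1 2}cardV token_lambda_max_le_setC ?cardV //=.
  rewrite -[in leRHS](subKn kn) -{2}cardV; apply: token_lambda_max_le_setC => //.
  by rewrite cardV leq_subr.
have slope i j : (i <= j)%N -> (j < n)%N -> h j.+1 - h j <= h i.+1 - h i.
  move=> ij; rewrite -(subnKC ij); elim: (j - i)%N => [|d IH]; first by rewrite addn0.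
  rewrite addnS => lt; apply: le_trans (IH (ltnW lt)).
  by have := concave _ lt; lra.
split=> // [k k0 kn|k kn].
  by case: k k0 kn => // k _ kn; rewrite subn1 addn1; apply: concave; lia.
(* By symmetry the slope at [n - k.+1] is the negative of the slope at [k]; since it is not larger,
   the slope at [k] is nonnegative. *)
rewrite addn1; have := slope k (n - k.+1)%N.
have -> : (n - k.+1).+1 = (n - k)%N by lia.
rewrite -!symm; [|lia|lia].
by move=> /(_ ltac:(lia) ltac:(lia)); lra.
Qed.
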